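(* Let $\mathsf{M}$ be any lambda term. Then the density, among all lambda terms, of the terms that do not have $\mathsf{M}$ as a subterm is $0$.
   Context: Lambda terms in de Bruijn notation: $M ::= \underline{0} \mid S\,n \mid \lambda M \mid M\,M$ with de Bruijn indices $n ::= \underline{0}\mid S\,n$ (not necessarily closed). Size: $|\underline{0}|=1$, $|S\,n|=|n|+1$, $|\lambda M|=|M|+1$, $|M_1M_2|=|M_1|+|M_2|+1$. A term $N$ has $\mathsf{M}$ as a subterm if $N=\mathsf{M}$, or $N=\lambda N_1$ and $N_1$ has $\mathsf{M}$ as a subterm, or $N = N_1N_2$ and $N_1$ or $N_2$ has $\mathsf{M}$ as a subterm. The density of a set $\mathcal{A}$ of terms among all terms is $\lim_{n\to\infty}A_n/L_n$, where $A_n$ is the number of elements of $\mathcal{A}$ of size $n$ and $L_n$ the number of all lambda terms of size $n$. *)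

(* Defs.v *)
From HB Require Import structures.
From mathcomp Require Import all_boot all_order all_algebra finmap.
From mathcomp Require Import all_classical all_reals all_analysis.

Set Implicit Arguments.
Unset Strict Implicit.
Unset Printing Implicit Defensive.

Import Order.TTheory GRing.Theory Num.Theory numFieldNormedType.Exports.
Local Open Scope classical_set_scope.
Local Open Scope ring_scope.

(* Lambda terms in de Bruijn notation, not necessarily closed. The index
   S (... (S 0)) with k successors is Var k; it is a single leaf, so that a
   smaller index is not a subterm of a larger one. *)
Inductive term : Type :=
| Var of nat
| Lam of term
| App of term & term.

Fixpoint term_encode (t : term) : GenTree.tree nat :=
  match t with
  | Var k => GenTree.Leaf k
  | Lam u => GenTree.Node 0 [:: term_encode u]
  | App u v => GenTree.Node 0 [:: term_encode u; term_encode v]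
  end.

Fixpoint term_decode (e : GenTree.tree nat) : term :=
  match e with
  | GenTree.Leaf k => Var k
  | GenTree.Node _ [:: u] => Lam (term_decode u)
  | GenTree.Node _ [:: u; v] => App (term_decode u) (term_decode v)
  | _ => Var 0
  end.

Lemma term_encodeK : cancel term_encode term_decode.
Proof. by elim=> //= [u -> | u -> v ->]. Qed.

HB.instance Definition _ := Countable.copy term (can_type term_encodeK).

(* |0| = 1 and |S n| = |n| + 1. *)
Definition index_size (k : nat) : nat := k.+1.

Fixpoint term_size (t : term) : nat :=
  match t with
  | Var k => index_size k
  | Lam u => (term_size u + 1)%N
  | App u v => (term_size u + term_size v + 1)%N
  end.

(* N has M as a subterm; note the order of the arguments. *)
Fixpoint has_subterm (M N : term) : Prop :=
  N = M \/
  match N with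
  | Var _ => False
  | Lam N1 => has_subterm M N1
  | App N1 N2 => has_subterm M N1 \/ has_subterm M N2
  end.

Lemma finite_term_size_le (n : nat) :
  finite_set [set t : term | (term_size t <= n)%N].
Proof.
elim: n => [|n IHn].
  apply: (sub_finite_set (B := set0)) => // -[k|u|u v] /=;
    by rewrite ?addn1.
pose S := [set t : term | (term_size t <= n)%N].
pose B := [set Var k | k in `I_n.+1] `|` ([set Lam u | u in S] `|`
  [set App p.1 p.2 | p in S `*` S]).
apply: (sub_finite_set (B := B)).
  move=> [k|u|u v] /= h.
  - by left; exists k.
  - by right; left; exists u => //=; rewrite addn1 in h.
  - right; right; exists (u, v) => //=; rewrite addn1 ltnS in h.
    by split; apply: leq_trans h; rewrite ?leq_addr ?leq_addl.
rewrite !finite_setU; split; first exact/finite_image/finite_II.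
split; first exact: finite_image.
exact/finite_image/finite_setX.
Qed.

Lemma finite_term_size (A : set term) (n : nat) :
  finite_set [set t : term | A t /\ term_size t = n].
Proof.
apply: sub_finite_set (finite_term_size_le n) => t /= [_ ->].
exact: leqnn.
Qed.

(* fset_set is the empty set on infinite sets; finite_term_size shows that this
   default value is never used here. *)
Definition count_size (A : set term) (n : nat) : nat :=
  #|` fset_set [set t : term | A t /\ term_size t = n] |.

(* There is no term of size 0, so the quotient at n = 0 is 0 / 0 = 0, which is
   irrelevant to the limit; there is a term of every positive size. *)
Definition has_density (R : realType) (A : set term) (d : R) : Prop :=
  ((count_size A n)%:R / (count_size setT n)%:R : R) @[n --> \oo] --> d.

(* Main.v *)
(** Let L_n count the terms of size n, A_n those avoiding M, and m = |M|.

    Every unit of the size of a term N is a place where a copy of M can be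
    inserted, at the constant cost m + 3. If N avoids M, then N can be recovered
    from the result, since the inserted M is the only occurrence of M in function
    position that is met from the root; hence n A_n <= L_(n+m+3).

    On the other hand L_(n+1) <= 8 L_n for n > 0. Let the weight of a term be its
    size without the applications. As there is one application less than there are
    leaves, it exceeds half of the size. The convolution recurrences for L_n and
    for the total weight W_n of the terms of size n give W_(n+1) <= 4 n L_n by
    induction, whereas (n + 2) L_(n+1) <= 2 W_(n+1).

    Therefore A_n / L_n <= 8^(m+3) / n. *)

Require Import Defs.
From mathcomp Require Import all_boot all_order all_algebra.
From mathcomp Require Import all_classical all_reals all_analysis.
From mathcomp Require Import finmap zify.

Import Order.TTheory GRing.Theory Num.Theory numFieldNormedType.Exports.

Local Open Scope classical_set_scope.
Local Open Scope ring_scope.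

(** * Enumeration of the terms of a given size *)

(* [d] only bounds the recursion depth: the result is correct for [n <= d]. *)
Fixpoint terms_fuel (d n : nat) : seq term :=
  match d, n with
  | d'.+1, n'.+1 =>
      Var n' :: [seq Lam u | u <- terms_fuel d' n'] ++
      flatten [seq [seq App u v | u <- terms_fuel d' i,
                                  v <- terms_fuel d' (n' - i)%N]
              | i <- iota 0 n'.+1]
  | _, _ => [::]
  end.

Arguments terms_fuel : simpl never.

Lemma terms_fuelS (d n : nat) : terms_fuel d.+1 n.+1 =
  Var n :: [seq Lam u | u <- terms_fuel d n] ++
  flatten [seq [seq App u v | u <- terms_fuel d i,
                              v <- terms_fuel d (n - i)%N]
          | i <- iota 0 n.+1].
Proof. by []. Qed.

Definition terms (n : nat) : seq term := terms_fuel n n.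

Lemma term_size_gt0 (t : term) : (0 < term_size t)%N.
Proof. by case: t => [k|u|u v] /=; rewrite ?addn1. Qed.

Lemma mem_terms_fuel (d n : nat) (t : term) :
  (n <= d)%N -> (t \in terms_fuel d n) = (term_size t == n).
Proof.
elim: d n t => [|d IHd] [|n] t led //.
- by rewrite in_nil gtn_eqF ?term_size_gt0.
- by rewrite in_nil gtn_eqF ?term_size_gt0.
rewrite ltnS in led; rewrite terms_fuelS in_cons mem_cat.
case: t => [k|u|u v]; rewrite [term_size _]/=.
- rewrite [_ \in map _ _](introF mapP); last by case.
  rewrite [_ \in flatten _](introF flatten_mapP); last first.
    by case=> i _ /allpairsP[[]] ? ? [].
  by rewrite !orbF eqSS; apply/eqP/eqP => [[]|->].
- rewrite [_ \in flatten _](introF flatten_mapP); last first.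
    by case=> i _ /allpairsP[[]] ? ? [].
  rewrite mem_map; last by move=> ? ? [].
  by rewrite IHd // orbF addn1 eqSS; apply/orb_idl => /eqP.
- rewrite [_ \in map _ _](introF mapP); last by case.
  apply/idP/eqP => [/orP[/eqP //|]|].
    case/flatten_mapP => i; rewrite mem_iota => /andP[_ lti].
    case/allpairsP => -[u' v'] /= [hu hv [-> ->]].
    move: hu hv; rewrite !IHd; [move=> /eqP hu /eqP hv|lia|lia]; lia.
  move=> e; apply/orP; right; apply/flatten_mapP.
  exists (term_size u); first by rewrite mem_iota; lia.
  by apply: allpairs_f; rewrite IHd; lia.
Qed.

Lemma mem_terms (n : nat) (t : term) : (t \in terms n) = (term_size t == n).
Proof. exact: mem_terms_fuel. Qed.

Lemma terms_fuel_uniq (d n : nat) : (n <= d)%N -> uniq (terms_fuel d n).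
Proof.
elim: d n => [|d IHd] [|n] // led; rewrite ltnS in led.
rewrite terms_fuelS cons_uniq mem_cat; apply/andP; split.
  apply/negP => /orP[/mapP[]//|/flatten_mapP[i _ /allpairsP[[]] ? ? []//]].
rewrite cat_uniq map_inj_uniq; last by move=> ? ? [].
rewrite IHd // andTb; apply/andP; split.
  apply/hasPn => t /flatten_mapP[i _ /allpairsP[[u v] /= [_ _ ->]]].
  by apply/mapP => -[].
(* Generalised from [iota 0 n.+1] for the induction. Blocks for different [i] are disjoint because
   [i] is the size of the function part. *)
have : forall s, uniq s -> (forall i, i \in s -> (i <= n)%N) ->
  uniq (flatten [seq [seq App u v | u <- terms_fuel d i,
                        v <- terms_fuel d (n - i)%N] | i <- s]).
  elim=> //= i s IHs /andP[nis us] les; rewrite cat_uniq IHs //; last first.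
    by move=> j js; apply: les; rewrite in_cons js orbT.
  have lei : (i <= n)%N by apply: les; rewrite mem_head.
  rewrite andbT allpairs_uniq ?IHd//; [|lia|lia|]; last first.
    by move=> [? ?] [? ?] _ _ /= [-> ->].
  apply/hasPn => t /flatten_mapP[j js /allpairsP[[u v] /= [hu _ ->]]].
  apply/allpairsP => -[[u' v'] /= [hu' _ [eu ev]]].
  have lej : (j <= n)%N by apply: les; rewrite in_cons js orbT.
  move: hu hu'; rewrite -eu !mem_terms_fuel; [|lia|lia].
  by move=> /eqP uj /eqP ui; rewrite -ui uj js in nis.
apply; first exact: iota_uniq.
by move=> i; rewrite mem_iota; lia.
Qed.

Lemma terms_uniq (n : nat) : uniq (terms n).
Proof. exact: terms_fuel_uniq. Qed.

Lemma terms_fuelE (d n : nat) : (n <= d)%N -> perm_eq (terms_fuel d n) (terms n).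
Proof.
move=> led; apply: uniq_perm; [exact: terms_fuel_uniq|exact: terms_uniq|].
by move=> t; rewrite mem_terms mem_terms_fuel.
Qed.

(** The constant function 1 yields the recurrence for L_n, and [weight] the one for W_n. The
    summands for [i = 0] and [i = n] vanish, as no term has size 0. *)
Lemma big_termsS (F : term -> nat) (n : nat) :
  (\sum_(t <- terms n.+1) F t = F (Var n) + \sum_(u <- terms n) F (Lam u) +
  \sum_(i < n.+1) \sum_(u <- terms i) \sum_(v <- terms (n - i)) F (App u v))%N.
Proof.
rewrite {1}/terms terms_fuelS.
rewrite big_cons big_cat big_map addnA; congr (_ + _)%N.
rewrite big_flatten big_map -/(index_iota 0 n.+1) big_mkord.
apply: eq_bigr => i _; rewrite big_allpairs_dep.
have lei : (i <= n)%N by rewrite -ltnS.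
rewrite (perm_big _ (terms_fuelE _ _ lei)); apply: eq_bigr => u _.
by apply/perm_big/terms_fuelE/leq_subr.
Qed.

Lemma count_sizeE (A : set term) (n : nat) :
  Defs.count_size A n = count (fun t => `[< A t >]) (terms n).
Proof.
rewrite /Defs.count_size -size_filter; apply/perm_size/uniq_perm.
- exact: fset_uniq.
- exact/filter_uniq/terms_uniq.
move=> t; rewrite mem_filter mem_terms in_fset_set; last exact: finite_term_size.
apply/idP/andP => [/set_mem[At /eqP tn]|[/asboolP At /eqP tn]].
  by split=> //; exact/asboolP.
exact/mem_set.
Qed.

(** * Exponential growth bound for the number of terms *)

Definition num_terms (n : nat) : nat := size (terms n).

Fixpoint weight (t : term) : nat :=
  match t with
  | Var k => k.+1
  | Lam u => (weight u).+1
  | App u v => weight u + weight v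
  end%N.

Definition total_weight (n : nat) : nat := (\sum_(t <- terms n) weight t)%N.

Lemma size_lt_weight (t : term) : (term_size t < 2 * weight t)%N.
Proof. by elim: t => [k|u IHu|u IHu v IHv] /=; rewrite /Defs.index_size; lia. Qed.

Lemma num_termsS (n : nat) : (num_terms n.+1 =
  1 + num_terms n + \sum_(i < n.+1) num_terms i * num_terms (n - i))%N.
Proof.
rewrite /num_terms -(sum1_size (terms n.+1)) big_termsS sum1_size.
congr (_ + _)%N; apply: eq_bigr => i _.
by under eq_bigr do rewrite sum1_size; rewrite big_const_seq count_predT iter_addn_0 mulnC.
Qed.

Lemma total_weightS (n : nat) : (total_weight n.+1 =
  n.+1 + (total_weight n + num_terms n) +
  2 * \sum_(i < n.+1) total_weight i * num_terms (n - i))%N.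
Proof.
rewrite /total_weight big_termsS /=; congr (_ + _ + _)%N.
  by under eq_bigr do rewrite -addn1; rewrite big_split /= sum1_size.
(* Under the reflection of [i] to [n - i], function parts and arguments contribute equal weights,
   whence the factor 2. *)
rewrite mulSn mul1n [in X in (_ = _ + X)%N](reindex_inj rev_ord_inj) -big_split /=.
apply: eq_bigr => i _; rewrite subSS subKn -1?ltnS//.
under eq_bigr do rewrite big_split /= big_const_seq count_predT iter_addn_0.
rewrite big_split /= big_const_seq count_predT iter_addn_0.
by rewrite -big_distrl.
Qed.

(** The correction at [n = 0] is forced by W_1 = 1 and L_0 = 0. *)
Lemma total_weightS_le (n : nat) :
  (total_weight n.+1 <= 4 * (n * num_terms n) + (n == 0))%N.
Proof.
have [m] := ubnP n; elim: m n => // m IHm [_|n ltnm].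
  by rewrite total_weightS big_ord1 /total_weight /num_terms !big_nil.
pose X := (\sum_(i < n.+1) num_terms i * num_terms (n - i))%N.
pose Y := (\sum_(i < n.+1) i * num_terms i * num_terms (n - i))%N.
(* Reflection turns the factor [i] into [n - i], and the two add up to [n]. *)
have YX : (2 * Y = n * X)%N.
  rewrite mulSn mul1n {2}/Y (reindex_inj rev_ord_inj) -big_split big_distrr /=.
  apply: eq_bigr => i _; have lei : (i <= n)%N by rewrite -ltnS.
  rewrite subSS subKn // -mulnA -mulnA (mulnC (num_terms (n - i))) -mulnDl.
  by rewrite subnKC.
have conv : (\sum_(i < n.+2) total_weight i * num_terms (n.+1 - i) <=
             num_terms n + 4 * Y)%N.
  rewrite big_ord_recl {1}/total_weight big_nil mul0n add0n big_distrr /=.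
  (* the term i = 0 absorbs the exceptional W_1 = 1 *)
  have -> : (num_terms n = \sum_(i < n.+1) (i == 0 :> nat) * num_terms (n - i))%N.
    by rewrite big_ord_recl big1 ?mul1n ?subn0 ?addn0// => i _; rewrite mul0n.
  rewrite -big_split; apply: leq_sum => i _ /=.
  rewrite /bump leq0n add1n subSS !mulnA -mulnDl leq_mul2r addnC -mulnA.
  by rewrite IHm ?orbT//; apply: leq_trans (ltn_ord i) _; rewrite -ltnS.
(* The left side is at most (n + 3) + [n = 0] + (4n + 3) L_n + (4n + 1) X, the right side is 4 (n +
   1) (1 + L_n + X). At n = 0 the constants agree. *)
have := IHm n ltnm; rewrite [total_weight n.+2]total_weightS num_termsS -/X.
move: conv YX; move: (total_weight n.+1) (num_terms n) (\sum_(i < _) _)%N X Y.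
by case: (n) => [|k]; rewrite ?mul0n /=; nia.
Qed.

Lemma num_termsS_le (n : nat) : (0 < n -> num_terms n.+1 <= 8 * num_terms n)%N.
Proof.
move=> n0; have := total_weightS_le n; rewrite [n == 0]gtn_eqF// addn0.
have : (num_terms n.+1 * n.+2 <= 2 * total_weight n.+1)%N.
  rewrite /num_terms -sum1_size big_distrl /total_weight big_distrr /=.
  rewrite big_seq [leqRHS]big_seq; apply: leq_sum => t; rewrite mem_terms mul1n.
  by move=> /eqP <-; exact: size_lt_weight.
nia.
Qed.

Lemma num_termsD_le (n c : nat) :
  (0 < n -> num_terms (n + c) <= 8 ^ c * num_terms n)%N.
Proof.
move=> n0; elim: c => [|c IHc]; first by rewrite addn0 mul1n.
rewrite addnS expnS -mulnA (leq_trans (num_termsS_le _ _))//; last first.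
  by rewrite leq_mul2l.
by rewrite addn_gt0 n0.
Qed.

(** * Insertion of copies of [M] and their removal *)

(* The two shapes of the argument of the inserted [M], an application of two
   variables and two abstractions, tell a split variable from a whole subterm
   and cost the same size. *)
Fixpoint insertions (M N : term) : seq term :=
  match N with
  | Var k => [seq App M (App (Var i) (Var (k - i))) | i <- iota 0 k.+1]
  | Lam u => App M (Lam (Lam N)) :: [seq Lam u' | u' <- insertions M u]
  | App u v => App M (Lam (Lam N)) ::
      [seq App u' v | u' <- insertions M u] ++
      [seq App u v' | v' <- insertions M v]
  end.

Fixpoint remove_insertion (M N : term) : term :=
  match N with
  | Var k => Var k
  | Lam u => Lam (remove_insertion M u)
  | App u v =>
      if u == M then
        match v with
        | Lam (Lam w) => w
        | App (Var i) (Var j) => Var (i + j)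
        | _ => v
        end
      else App (remove_insertion M u) (remove_insertion M v)
  end.

Lemma size_insertions (M N : term) : size (insertions M N) = term_size N.
Proof.
elim: N => [k|u IHu|u IHu v IHv]; first by rewrite size_map size_iota.
  by rewrite /= size_map IHu addn1.
by rewrite /= size_cat !size_map IHu IHv addn1.
Qed.

(** The 3 counts the new application and two abstractions or, for a split variable, two applications
    and one unit, since the indices [i] and [k - i] have total size k + 2. *)
Lemma term_size_insertion (M N t : term) : t \in insertions M N ->
  term_size t = (term_size N + (term_size M + 3))%N.
Proof.
elim: N t => [k|u IHu|u IHu v IHv] t.
- case/mapP => i; rewrite mem_iota => /andP[_ ltik] -> /=.
  by rewrite /Defs.index_size; lia.
- by rewrite in_cons => /orP[/eqP ->|/mapP[u' /IHu e ->]] /=; lia.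
- rewrite /= in_cons mem_cat.
  case/or3P => [/eqP ->|/mapP[u' /IHu e ->]|/mapP[v' /IHv e ->]] /=; lia.
Qed.

Lemma insertion_neq (M N t : term) : t \in insertions M N -> t != M.
Proof.
by move=> /term_size_insertion e; apply/eqP => tM; rewrite tM in e; lia.
Qed.

Lemma has_subterm_refl (M : term) : has_subterm M M.
Proof. by case: M => *; left. Qed.

Lemma remove_insertion_id (M N : term) :
  ~ has_subterm M N -> remove_insertion M N = N.
Proof.
elim: N => [k|u IHu|u IHu v IHv] //= avoid.
  by rewrite IHu// => h; apply: avoid; right.
case: eqP => [uM|_].
  by case: avoid; right; left; rewrite uM; exact: has_subterm_refl.
by rewrite IHu ?IHv// => h; apply: avoid; right; [right|left].
Qed.

(** On the way down to the inserted copy, no function part equals [M]: an untouched one is a subterm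
    of [N], and a modified one is larger than [M]. *)
Lemma insertionsK (M N t : term) : ~ has_subterm M N ->
  t \in insertions M N -> remove_insertion M t = N.
Proof.
elim: N t => [k|u IHu|u IHu v IHv] t avoid.
- case/mapP => i; rewrite mem_iota => /andP[_ ltik] -> /=.
  by rewrite eqxx subnKC.
- rewrite /= in_cons => /orP[/eqP ->|/mapP[u' u'P ->]] /=; first by rewrite eqxx.
  by rewrite IHu// => h; apply: avoid; right.
- have avoidu : ~ has_subterm M u by move=> h; apply: avoid; right; left.
  have avoidv : ~ has_subterm M v by move=> h; apply: avoid; right; right.
  rewrite /= in_cons mem_cat.
  case/or3P => [/eqP ->|/mapP[u' u'P ->]|/mapP[v' v'P ->]] /=.
  + by rewrite eqxx.
  + by rewrite (negPf (insertion_neq _ _ _ u'P)) IHu// remove_insertion_id.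
  + case: eqP => [uM|_]; last by rewrite (IHv _ avoidv v'P) remove_insertion_id.
    by case: avoidu; rewrite uM; exact: has_subterm_refl.
Qed.

Lemma insertions_uniq (M N : term) :
  ~ has_subterm M N -> uniq (insertions M N).
Proof.
elim: N => [k|u IHu|u IHu v IHv] avoid.
- by rewrite map_inj_uniq ?iota_uniq// => i j [].
- rewrite /= map_inj_uniq; last by move=> ? ? [].
  rewrite IHu ?andbT; last by move=> h; apply: avoid; right.
  by apply/mapP => -[].
have avoidu : ~ has_subterm M u by move=> h; apply: avoid; right; left.
have avoidv : ~ has_subterm M v by move=> h; apply: avoid; right; right.
rewrite /= mem_cat cat_uniq !map_inj_uniq; [|by move=> ? ? []..].
rewrite IHu// IHv// andbT /=; apply/andP; split.
  apply/negP => /orP[/mapP[u' /insertion_neq + [uM _]]|/mapP[v' _ [uM _]]].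
    by rewrite uM eqxx.
  by apply: avoidu; rewrite -uM; exact: has_subterm_refl.
(* An insertion in the argument keeps the function part, one in the function part enlarges it. *)
apply/hasPn => t /mapP[v' _ ->]; apply/mapP => -[u' /term_size_insertion e [uu _]].
by rewrite -uu in e; lia.
Qed.

(** * Comparison of the counts and the limit *)

Lemma count_size_avoid_le (M : term) (n : nat) :
  (n * Defs.count_size [set N | ~ has_subterm M N] n <=
   num_terms (n + (term_size M + 3)))%N.
Proof.
rewrite count_sizeE -size_filter; set s := (X in size X).
have sP N : N \in s -> ~ has_subterm M N /\ term_size N = n.
  by rewrite mem_filter mem_terms => /andP[/asboolP ? /eqP].
have -> : (n * size s = size [seq t | N <- s, t <- insertions M N])%N.
  rewrite size_allpairs_dep sumnE big_map (eq_big_seq (fun=> n)).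
    by rewrite big_const_seq count_predT iter_addn_0.
  by move=> N /sP[_ <-]; exact: size_insertions.
(* Insertions into different terms differ, since [remove_insertion] recovers the original term. *)
apply: uniq_leq_size.
  apply: allpairs_uniq_dep; first exact/filter_uniq/terms_uniq.
    by move=> N /sP[avoid _]; exact: insertions_uniq.
  move=> x y /allpairsPdep[N [t [/sP[avN _] tN ->]]].
  move=> /allpairsPdep[N' [t' [/sP[avN' _] tN' ->]]] /= tt'.
  suff NN' : N = N' by rewrite tt' NN'.
  by rewrite -(insertionsK _ _ _ avN tN) tt'; exact: insertionsK.
move=> t /allpairsPdep[N [t' [/sP[_ <-] t'N ->]]].
by rewrite mem_terms; apply/eqP/term_size_insertion.
Qed.

Theorem theorem2 (R : realType) (M : term) :
  has_density [set N : term | ~ has_subterm M N] (0 : R).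
Proof.
set A := [set N | _]; set c := (term_size M + 3)%N.
have sizeT n : Defs.count_size setT n = num_terms n.
  by rewrite count_sizeE (eq_count (a2 := predT)) ?count_predT// => t; exact/asboolT.
(* The shift avoids size 0, where L_0 = 0, and matches [harmonic n], which is 1 / (n + 1). *)
rewrite /has_density -cvg_shiftS.
apply: (@squeeze_cvgr _ _ _ _ (fun=> 0) (fun n => (8 ^ c)%:R * harmonic n)).
- near=> n; rewrite divr_ge0 ?ler0n//= sizeT.
  have L0 : (0 < num_terms n.+1)%N by rewrite /num_terms /terms terms_fuelS.
  rewrite ler_pdivrMr ?ltr0n// mulrAC ler_pdivlMr ?ltr0n// -!natrM ler_nat.
  rewrite mulnC (leq_trans (count_size_avoid_le M n.+1))//.
  exact: num_termsD_le.
- exact: cvg_cst.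
- by rewrite -[X in _ --> X](mulr0 (8 ^ c)%:R); apply: cvgMl_tmp; exact: cvg_harmonic.
Unshelve. all: by end_near.
Qed.
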